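(* Let $m_1,m_2,\ldots$ be integers with $m_i\ge 2$ for all $i$, and let $$A=\Big\{\epsilon_0+\epsilon_2m_1m_2+\cdots+\epsilon_{2k-2}m_1\cdots m_{2k-2}+\cdots:\ \epsilon_{2i}\in\{0,1,\ldots,m_{2i+1}-1\}\Big\},$$ $$B=\Big\{\epsilon_1m_1+\epsilon_3m_1m_2m_3+\cdots+\epsilon_{2k-1}m_1\cdots m_{2k-1}+\cdots:\ \epsilon_{2i-1}\in\{0,1,\ldots,m_{2i}-1\}\Big\},$$ where in each element only finitely many digits $\epsilon_j$ are nonzero. Then $$SX(A,B)=\limsup_{s\to\infty}\max\left\{\frac{m_1m_3\cdots m_{2s-1}}{\sqrt{(m_1-1)+(m_3-1)m_1m_2+\cdots+(m_{2s-1}-1)m_1m_2\cdots m_{2s-2}}},\ \frac{m_2m_4\cdots m_{2s}}{\sqrt{(m_2-1)m_1+(m_4-1)m_1m_2m_3+\cdots+(m_{2s}-1)m_1m_2\cdots m_{2s-1}}}\right\}.$$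
   Context: For a set $A$ of nonnegative integers, $A(x)$ denotes the number of elements $a\in A$ with $a\le x$. For sets $A,B$ of nonnegative integers, $SX(A,B)=\limsup_{x\to\infty}\frac{\max\{A(x),B(x)\}}{\sqrt x}$. (The sets $A,B$ above are perfect additive complements: every nonnegative integer has exactly one representation $a+b$ with $a\in A$, $b\in B$.) *)

(* Defs.v *)
From mathcomp Require Import all_boot all_order all_algebra finmap.
From mathcomp Require Import all_classical all_reals all_analysis.

Set Implicit Arguments.
Unset Strict Implicit.
Unset Printing Implicit Defensive.
Import Order.TTheory GRing.Theory Num.Theory.
Import numFieldNormedType.Exports.

Local Open Scope classical_set_scope.

(* The counting function [A(x)], for a real argument [x]. The set is finite,
   so [fset_set] does not fall back to its default value. *)
Definition counting_fun (R : realType) (A : set nat) (x : R) : nat :=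
  #|` fset_set [set a | A a /\ (a%:R <= x)%R] |%fset.

(* The limsup is taken in the extended reals: it may be [+oo]. *)
Definition SX (R : realType) (A B : set nat) : \bar R :=
  limf_esup
    (fun x : R =>
       ((maxn (counting_fun A x) (counting_fun B x))%:R / Num.sqrt x)%:E)
    (pinfty_nbhs R).

(* [m_1 m_2 ... m_k]; the value [m 0] is never used. *)
Definition mprod (m : nat -> nat) (k : nat) : nat :=
  \prod_(1 <= j < k.+1) m j.

(* Finite support of the digits is witnessed by the bound [N]. *)
Definition setA (m : nat -> nat) : set nat :=
  [set a | exists (eps : nat -> nat) (N : nat),
     [/\ forall i, eps (2 * i) < m (2 * i + 1),
         forall i, N <= i -> eps (2 * i) = 0
       & a = \sum_(i < N) eps (2 * i) * mprod m (2 * i)] ].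

(* The index [i >= 1] of [epsilon_(2i-1)] is shifted to start at [0]. *)
Definition setB (m : nat -> nat) : set nat :=
  [set b | exists (eps : nat -> nat) (N : nat),
     [/\ forall i, eps (2 * i + 1) < m (2 * i + 2),
         forall i, N <= i -> eps (2 * i + 1) = 0
       & b = \sum_(i < N) eps (2 * i + 1) * mprod m (2 * i + 1)] ].

(* Main.v *)
Require Import Defs.
From mathcomp Require Import all_boot all_order all_algebra.
From mathcomp Require Import all_classical all_reals all_analysis.
From mathcomp Require Import zify lra.
Import Order.TTheory GRing.Theory Num.Theory.
Import numFieldNormedType.Exports.

(** Write [P k = m_1 m_3 ... m_(2k-1)] and [Q k = m_2 m_4 ... m_(2k)], so that
    the weights of [A] are [P i * Q i].  If [n] has digits [d_i] in the mixed
    radix [m_1, m_3, ...], then the [n]-th element of [A] (from [n = 0]) is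
    [g n = \sum_i d_i P_i Q_i], and Abel summation gives
    [g n = Q_0 n + \sum_i (Q_(i+1) - Q_i) P_(i+1) floor (n / P_(i+1))], which is
    increasing in [n].  Dropping remainders, [g n >= Q_s n - c_s] for
    [n < P_(s+1)], with equality at [n = P_s - 1] and [n = P_(s+1) - 1].  Since
    [N^2] over a positive affine function of [N] is convex, [A(x) / sqrt x] with
    [P_s <= A(x) < P_(s+1)] is at most its value at [x = g (P_s - 1)] or at
    [x = g (P_(s+1) - 1)]; these are the terms of the limsup on the right.  The
    set [B] is treated alike, with [Q] as radix product and weights
    [Q i * P i.+1]. *)

Local Open Scope nat_scope.

(** * Mixed-radix expansions and the increasing enumeration [reweight] *)

Definition radix_prod (r : nat -> nat) (k : nat) : nat := \prod_(i < k) r i.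

Lemma radix_prod0 (r : nat -> nat) : radix_prod r 0 = 1.
Proof. by rewrite /radix_prod big_ord0. Qed.

Lemma radix_prodS (r : nat -> nat) (k : nat) :
  radix_prod r k.+1 = radix_prod r k * r k.
Proof. by rewrite /radix_prod big_ord_recr. Qed.

Lemma dvdn_radix_prod (r : nat -> nat) (j k : nat) :
  j <= k -> radix_prod r j %| radix_prod r k.
Proof.
move=> /subnKC <-; elim: (k - j) => [|i IH]; first by rewrite addn0.
by rewrite addnS radix_prodS dvdn_mulr.
Qed.

Lemma ltn_radix_prod (r : nat -> nat) (k : nat) :
  (forall i, 1 < r i) -> k < radix_prod r k.
Proof.
move=> r_gt1; elim: k => [|k IH]; first by rewrite radix_prod0.
by rewrite radix_prodS; have := r_gt1 k; nia.
Qed.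

Lemma radix_prod_gt0 (r : nat -> nat) (k : nat) :
  (forall i, 1 < r i) -> 0 < radix_prod r k.
Proof. by move=> r_gt1; apply: leq_ltn_trans (ltn_radix_prod r k r_gt1). Qed.

Lemma leq_radix_prod (r : nat -> nat) (j k : nat) :
  (forall i, 1 < r i) -> j <= k -> radix_prod r j <= radix_prod r k.
Proof.
by move=> r_gt1 jk; rewrite dvdn_leq ?radix_prod_gt0 ?dvdn_radix_prod.
Qed.

Lemma digit_sum_lt (r d : nat -> nat) (k : nat) :
  (forall i, d i < r i) -> \sum_(i < k) d i * radix_prod r i < radix_prod r k.
Proof.
move=> dr; elim: k => [|k IH]; first by rewrite big_ord0 radix_prod0.
rewrite big_ord_recr /= radix_prodS; apply: leq_trans (leq_mul (leqnn _) (dr k)).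
by rewrite mulnS mulnC ltn_add2r.
Qed.

Lemma digit_expansion (r : nat -> nat) (n k : nat) :
  (forall i, 1 < r i) -> n < radix_prod r k ->
  n = \sum_(i < k) (n %/ radix_prod r i) %% r i * radix_prod r i.
Proof.
move=> r_gt1 nk.
(* The truncated expansion is exact once the quotient left over is kept; for [j = k] that quotient
   vanishes. *)
suff {nk}E j : n = \sum_(i < j) (n %/ radix_prod r i) %% r i * radix_prod r i
                + n %/ radix_prod r j * radix_prod r j.
  by rewrite {1}(E k) (divn_small nk) mul0n addn0.
elim: j => [|j IH]; first by rewrite big_ord0 radix_prod0 divn1 muln1.
rewrite big_ord_recr /= radix_prodS divnMA {1}IH.
rewrite {1}(divn_eq (n %/ radix_prod r j) (r j)) mulnDl.
by rewrite -addnA [X in _ = _ + X]addnC -mulnA (mulnC (r j)).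
Qed.

Lemma max_digit_sum (r : nat -> nat) (k : nat) :
  (forall i, 1 < r i) ->
  \sum_(i < k) (r i - 1) * radix_prod r i = (radix_prod r k).-1.
Proof.
move=> r_gt1; elim: k => [|k IH]; first by rewrite big_ord0 radix_prod0.
rewrite big_ord_recr /= radix_prodS IH.
by have := r_gt1 k; have := radix_prod_gt0 _ k r_gt1; nia.
Qed.

(* Abel summation turns [\sum_i d_i P_i Q_i], where the [d_i] are the digits of
   [n] in the mixed radix [r] and [P = radix_prod r], into this form, in which
   monotonicity in [n] is apparent. *)
Definition reweight_upto (r Q : nat -> nat) (k n : nat) : nat :=
  Q 0 * n + \sum_(i < k)
    (Q i.+1 - Q i) * (n %/ radix_prod r i.+1 * radix_prod r i.+1).

(* The summands with [i >= n] vanish. *)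
Definition reweight (r Q : nat -> nat) (n : nat) : nat := reweight_upto r Q n n.

Lemma reweight_uptoS (r Q : nat -> nat) (k n : nat) :
  reweight_upto r Q k.+1 n = reweight_upto r Q k n +
    (Q k.+1 - Q k) * (n %/ radix_prod r k.+1 * radix_prod r k.+1).
Proof. by rewrite /reweight_upto big_ord_recr addnA. Qed.

(** Beyond level [j] all radix products exceed [n], so the added quotients are zero. *)
Lemma reweight_upto_stable (r Q : nat -> nat) (j k n : nat) :
  (forall i, 1 < r i) -> n < radix_prod r j.+1 -> j <= k ->
  reweight_upto r Q k n = reweight_upto r Q j n.
Proof.
move=> r_gt1 nj /subnKC <-; elim: (k - j) => [|i IH]; first by rewrite addn0.
rewrite addnS reweight_uptoS IH divn_small ?mul0n ?muln0 ?addn0 //.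
by apply: leq_trans nj _; apply: leq_radix_prod => //; lia.
Qed.

Lemma reweight_eq_upto (r Q : nat -> nat) (k n : nat) :
  (forall i, 1 < r i) -> n < radix_prod r k.+1 ->
  reweight r Q n = reweight_upto r Q k n.
Proof.
move=> r_gt1 nk; rewrite /reweight.
have nn : n < radix_prod r n.+1 by have := ltn_radix_prod _ n.+1 r_gt1; lia.
by case: (leqP n k) => h; rewrite ?(reweight_upto_stable _ _ _ _ _ r_gt1 nn h) //
  (reweight_upto_stable _ _ _ _ _ r_gt1 nk (ltnW h)).
Qed.

Lemma reweight_upto_lt (r Q : nat -> nat) (k n p : nat) :
  0 < Q 0 -> n < p -> reweight_upto r Q k n < reweight_upto r Q k p.
Proof.
move=> Q0 np; rewrite /reweight_upto -addSn leq_add ?ltn_pmul2l //.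
by apply: leq_sum => i _; rewrite leq_mul2l leq_mul2r leq_div2r ?orbT // ltnW.
Qed.

Lemma reweight_lt (r Q : nat -> nat) (n p : nat) :
  (forall i, 1 < r i) -> 0 < Q 0 -> n < p -> reweight r Q n < reweight r Q p.
Proof.
move=> r_gt1 Q0 np; have pp := ltn_radix_prod _ p.+1 r_gt1.
by rewrite !(reweight_eq_upto _ _ p) ?reweight_upto_lt //; lia.
Qed.

(** All radix products up to level [k] divide [e], so each rounded-down multiple shifts by exactly
    [e], and the coefficients telescope to [Q k]. *)
Lemma reweight_upto_addl (r Q : nat -> nat) (k e n : nat) :
  (forall i, 1 < r i) -> (forall i, Q i <= Q i.+1) -> radix_prod r k %| e ->
  reweight_upto r Q k (e + n) = e * Q k + reweight_upto r Q k n.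
Proof.
move=> r_gt1 Qle; elim: k => [|k IH] ke.
  by rewrite /reweight_upto !big_ord0; lia.
have {}IH := IH (dvdn_trans (dvdn_radix_prod _ _ _ (leqnSn k)) ke).
rewrite !reweight_uptoS IH divnDl // mulnDl divnK //.
by rewrite -{2}(subnKC (Qle k)); lia.
Qed.

(** Induction on the number of digits: the leading term is a multiple of [radix_prod r k], so
    [reweight_upto_addl] splits it off with weight [Q k]. *)
Lemma reweight_digit_sum (r Q d : nat -> nat) (k : nat) :
  (forall i, 1 < r i) -> (forall i, Q i <= Q i.+1) -> (forall i, d i < r i) ->
  reweight r Q (\sum_(i < k) d i * radix_prod r i) =
  \sum_(i < k) d i * (radix_prod r i * Q i).
Proof.
move=> r_gt1 Qle dr; elim: k => [|k IH].
  by rewrite !big_ord0 /reweight /reweight_upto big_ord0 muln0.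
have ltk := digit_sum_lt _ _ k dr; have ltk1 := digit_sum_lt _ _ k.+1 dr.
rewrite (reweight_eq_upto _ _ k) // !big_ord_recr /= -{}IH addnC.
rewrite reweight_upto_addl ?dvdn_mull // (reweight_eq_upto _ _ k) //; last first.
  by apply: leq_trans ltk _; apply: leq_radix_prod.
by rewrite mulnA addnC.
Qed.

(** All digits of [(radix_prod r k).-1] are maximal; this gives the sums under the square roots of
    the theorem. *)
Lemma reweight_max (r Q : nat -> nat) (k : nat) :
  (forall i, 1 < r i) -> (forall i, Q i <= Q i.+1) ->
  reweight r Q (radix_prod r k).-1 =
  \sum_(i < k) (r i - 1) * (radix_prod r i * Q i).
Proof.
move=> r_gt1 Qle; rewrite -max_digit_sum //.
rewrite (@reweight_digit_sum r Q (fun i => r i - 1)) //.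
by move=> i; have := r_gt1 i; lia.
Qed.

Definition digit_set (r w : nat -> nat) : set nat :=
  [set a | exists (d : nat -> nat) (N : nat),
     [/\ forall i, d i < r i, forall i, N <= i -> d i = 0
       & a = \sum_(i < N) d i * w i] ]%classic.

Lemma digit_set_range (r Q : nat -> nat) :
  (forall i, 1 < r i) -> (forall i, Q i <= Q i.+1) ->
  digit_set r (fun i => radix_prod r i * Q i) = range (reweight r Q).
Proof.
move=> r_gt1 Qle; apply/seteqP; split => [a [d [N [dr _ ->]]]|_ [n _ <-]].
  by exists (\sum_(i < N) d i * radix_prod r i); rewrite ?reweight_digit_sum.
have nn := ltn_radix_prod _ n r_gt1.
have dr i : (n %/ radix_prod r i) %% r i < r i.
  by rewrite ltn_mod; have := r_gt1 i; lia.
exists (fun i => (n %/ radix_prod r i) %% r i), n; split=> // [i ni|].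
  by rewrite divn_small ?mod0n // (leq_trans nn) ?leq_radix_prod.
by rewrite -(reweight_digit_sum _ _ _ n r_gt1 Qle dr) -digit_expansion.
Qed.

(** * Affine lower bound for [reweight] *)

(** The constant c_s of the overview: the total loss from rounding down when every remainder is
    maximal. *)
Definition reweight_gap (r Q : nat -> nat) (k : nat) : nat :=
  \sum_(i < k) (Q i.+1 - Q i) * (radix_prod r i.+1).-1.

Lemma reweight_upto_affine_le (r Q : nat -> nat) (k n : nat) :
  (forall i, 1 < r i) -> (forall i, Q i <= Q i.+1) ->
  Q k * n <= reweight_upto r Q k n + reweight_gap r Q k.
Proof.
move=> r_gt1 Qle; elim: k => [|k IH].
  by rewrite /reweight_upto /reweight_gap !big_ord0; lia.
rewrite reweight_uptoS /reweight_gap big_ord_recr /= -/(reweight_gap r Q k).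
rewrite -{1}(subnKC (Qle k)) mulnDl.
suff : (Q k.+1 - Q k) * n <= (Q k.+1 - Q k) *
  (n %/ radix_prod r k.+1 * radix_prod r k.+1 + (radix_prod r k.+1).-1) by lia.
rewrite leq_mul2l {1}(divn_eq n (radix_prod r k.+1)) leq_add2l.
by rewrite -ltnS prednK ?radix_prod_gt0 // ltn_mod radix_prod_gt0 ?orbT.
Qed.

(** Here [n] is -1 modulo every radix product up to level [k], so every remainder is maximal and
    nothing is lost in the affine bound. *)
Lemma reweight_upto_affine_eq (r Q : nat -> nat) (k n : nat) :
  (forall i, 1 < r i) -> (forall i, Q i <= Q i.+1) -> radix_prod r k %| n.+1 ->
  Q k * n = reweight_upto r Q k n + reweight_gap r Q k.
Proof.
move=> r_gt1 Qle; elim: k => [|k IH] kn.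
  by rewrite /reweight_upto /reweight_gap !big_ord0; lia.
have {}IH := IH (dvdn_trans (dvdn_radix_prod _ _ _ (leqnSn k)) kn).
rewrite reweight_uptoS /reweight_gap big_ord_recr /= -/(reweight_gap r Q k).
rewrite -{1}(subnKC (Qle k)) mulnDl IH.
suff E : n = n %/ radix_prod r k.+1 * radix_prod r k.+1 +
  (radix_prod r k.+1).-1 by rewrite [X in _ + _ * X = _]E mulnDr addnACA.
have P0 := radix_prod_gt0 _ k.+1 r_gt1.
move: kn P0 => /dvdnP[[//|q]].
move: (radix_prod r k.+1) => p; rewrite mulSn => nE p_gt0.
have -> : n = q * p + p.-1 by lia.
by rewrite divnMDl // (@divn_small p.-1) ?addn0 // prednK.
Qed.

(** * Counting functions of enumerated sets *)

Lemma ex_bracket (g : nat -> nat) (t : nat) :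
  {homo g : i j / i < j} -> g 0 <= t -> exists n, g n <= t < g n.+1.
Proof.
move=> g_lt g0; have gid n : n <= g n.
  by elim: n => // n IH; apply: leq_ltn_trans IH (g_lt _ _ (ltnSn n)).
have bnd n : g n <= t -> n <= t by apply: leq_trans.
case: (ex_maxnP (ex_intro (fun n => g n <= t) 0 g0) bnd) => n gn nmax.
by exists n; rewrite gn ltnNge; apply/negP => /nmax; rewrite ltnn.
Qed.

Lemma reweight_ge (r Q : nat -> nat) (n : nat) : 0 < Q 0 -> n <= reweight r Q n.
Proof.
move=> Q0; rewrite /reweight /reweight_upto.
by apply: leq_trans (leq_addr _ _); rewrite leq_pmull.
Qed.

Lemma reweight_gt0 (r Q : nat -> nat) (k : nat) :
  (forall i, 1 < r i) -> 0 < Q 0 -> 0 < k ->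
  0 < reweight r Q (radix_prod r k).-1.
Proof.
move=> r_gt1 Q0 k_gt0; apply: leq_trans (reweight_ge r _ _ Q0).
by have := ltn_radix_prod r k r_gt1; lia.
Qed.

Local Open Scope ring_scope.

Lemma counting_fun_range (R : realType) (g : nat -> nat) (x : R) (n : nat) :
  {homo g : i j / (i < j)%N} -> (g n)%:R <= x -> x < (g n.+1)%:R ->
  counting_fun (range g) x = n.+1.
Proof.
move=> g_lt gx xg; have g_le : {homo g : i j / (i <= j)%N}.
  by move=> i j; rewrite leq_eqVlt => /predU1P[->//|/g_lt/ltnW].
apply: card_fset_set.
suff -> : [set a | range g a /\ a%:R <= x]%classic = (g @` `I_n.+1)%classic.
  apply: inj_card_eq => i j _ _ gij.
  by case: (ltngtP i j) => // /g_lt; rewrite gij ltnn.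
apply/seteqP; split=> [_ [[i _ <-] gi]|_ [i /= lt_in <-]].
  exists i => //=; rewrite ltnNge; apply/negP => /g_le.
  by rewrite -(ler_nat R) => /le_trans/(_ gi); rewrite leNgt xg.
by split; [exists i | apply: le_trans gx; rewrite ler_nat g_le].
Qed.

(* On a segment, the square of the identity over a positive affine function is
   convex, hence maximal at an endpoint. *)
Lemma div_sqrt_affine_le (R : rcfType) (p q N a b h : R) :
  0 <= p -> p < q -> p <= N -> N <= q -> 0 < a -> 0 < b -> 0 < h ->
  (q - N) * a + (N - p) * b <= (q - p) * h ->
  N / Num.sqrt h <= Num.max (p / Num.sqrt a) (q / Num.sqrt b).
Proof.
move=> p0 pq pN Nq a0 b0 h0 hle; set K := Num.max _ _.
have K0 : 0 <= K by rewrite le_max divr_ge0 ?sqrtr_ge0.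
(* Squaring turns each comparison with [K] into one that is linear in the affine values. *)
have sq (u v : R) : 0 <= u -> 0 < v -> (u / Num.sqrt v <= K) = (u ^+ 2 <= K ^+ 2 * v).
  move=> u0 v0; rewrite ler_pdivrMr ?sqrtr_gt0 //.
  rewrite -[LHS](@ler_pXn2r _ 2) ?nnegrE ?mulr_ge0 ?sqrtr_ge0 //.
  by rewrite exprMn sqr_sqrtr // ltW.
have Ka : p ^+ 2 <= K ^+ 2 * a by rewrite -sq // le_max lexx.
have Kb : q ^+ 2 <= K ^+ 2 * b by rewrite -sq ?le_max ?lexx ?orbT //; lra.
rewrite sq //; last by lra.
rewrite -(@ler_pM2l _ (q - p)) ?subr_gt0 //.
have h1 : K ^+ 2 * ((q - N) * a + (N - p) * b) <= K ^+ 2 * ((q - p) * h).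
  by rewrite ler_wpM2l // sqr_ge0.
have h2 : (q - N) * p ^+ 2 <= (q - N) * (K ^+ 2 * a).
  by rewrite ler_wpM2l // subr_ge0.
have h3 : (N - p) * q ^+ 2 <= (N - p) * (K ^+ 2 * b).
  by rewrite ler_wpM2l // subr_ge0.
(* The convexity defect: this product equals (q - N) p^2 + (N - p) q^2 - (q - p) N^2. *)
have h4 : 0 <= (q - p) * ((N - p) * (q - N)).
  by rewrite !mulr_ge0 ?subr_ge0 // ltW.
by lra.
Qed.

Lemma counting_reweight_le (R : realType) (r Q : nat -> nat) (x : R) (s0 : nat) :
  (forall i, (1 < r i)%N) -> (forall i, (Q i <= Q i.+1)%N) -> (0 < Q 0)%N ->
  (0 < s0)%N -> (reweight r Q (radix_prod r s0).-1)%:R <= x ->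
  exists2 s, (s0 <= s)%N &
    (counting_fun (range (reweight r Q)) x)%:R / Num.sqrt x <=
    (radix_prod r s)%:R / Num.sqrt (reweight r Q (radix_prod r s).-1)%:R.
Proof.
move=> r_gt1 Qle Q0 s0_gt0 s0x.
have x0 : 0 <= x by apply: le_trans s0x.
have g_lt : {homo reweight r Q : i j / (i < j)%N}.
  by move=> i j; apply: reweight_lt.
have [] := ex_bracket _ (Num.truncn x) g_lt.
  by rewrite /reweight /reweight_upto big_ord0 muln0.
move=> n; rewrite truncn_ge_nat // truncn_lt_nat // => /andP[gx xg].
rewrite (counting_fun_range _ _ _ _ g_lt gx xg).
have P_lt i : (radix_prod r i < radix_prod r i.+1)%N.
  by rewrite radix_prodS ltn_Pmulr ?radix_prod_gt0.
have [] := ex_bracket (radix_prod r) n.+1; last move=> s /andP[sn ns].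
- by apply: homo_ltn => //; apply: ltn_trans.
- by rewrite radix_prod0.
have s0n : (radix_prod r s0 <= n.+1)%N.
  rewrite leqNgt; apply/negP => lt_n.
  have : (reweight r Q n.+1 <= reweight r Q (radix_prod r s0).-1)%N.
    have : (n.+1 <= (radix_prod r s0).-1)%N by lia.
    by rewrite leq_eqVlt => /predU1P[->//|/g_lt/ltnW].
  by rewrite -(ler_nat R) => /le_trans/(_ s0x); rewrite leNgt xg.
have s0s : (s0 <= s)%N.
  rewrite leqNgt; apply/negP => /(leq_radix_prod _ _ _ r_gt1) lt_s.
  by have := leq_trans lt_s s0n; rewrite leqNgt ns.
have s_gt0 : (0 < s)%N by apply: leq_trans s0s.
suff : n.+1%:R / Num.sqrt x <=
    Num.max ((radix_prod r s)%:R / Num.sqrt (reweight r Q (radix_prod r s).-1)%:R)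
    ((radix_prod r s.+1)%:R / Num.sqrt (reweight r Q (radix_prod r s.+1).-1)%:R).
  by rewrite le_max => /orP[le|le]; [exists s | exists s.+1; rewrite ?(leqW s0s)].
have gn_gt0 : (0 < reweight r Q n)%N.
  apply: leq_trans (reweight_ge r _ _ Q0).
  by have := ltn_radix_prod _ s r_gt1; lia.
(* Lowering [x] to the last element counted keeps the count and can only raise the ratio. *)
apply: (@le_trans _ _ (n.+1%:R / Num.sqrt (reweight r Q n)%:R)).
  rewrite ler_wpM2l // lef_pV2 ?posrE ?sqrtr_gt0 ?ltr0n //.
    by rewrite ler_sqrt.
  by apply: lt_le_trans gx; rewrite ltr0n.
have as0 := reweight_gt0 _ _ _ r_gt1 Q0 s_gt0.
have as1 := reweight_gt0 _ _ _ r_gt1 Q0 (ltn0Sn s).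
apply: div_sqrt_affine_le; rewrite ?ltr0n ?ltr_nat ?ler_nat //; first exact: ltnW.
have p_gt0 := radix_prod_gt0 _ s r_gt1; have q_gt0 := radix_prod_gt0 _ s.+1 r_gt1.
(* Both endpoints are taken at the same level [s], since [radix_prod r s] divides both products; so
   a single affine function passes through both values. *)
have Ea := @reweight_upto_affine_eq r Q s (radix_prod r s).-1 r_gt1 Qle.
have Eb := @reweight_upto_affine_eq r Q s (radix_prod r s.+1).-1 r_gt1 Qle.
have Lh := @reweight_upto_affine_le r Q s n r_gt1 Qle.
rewrite !prednK // in Ea Eb.
move: {Ea}(Ea (dvdnn _)) {Eb}(Eb (dvdn_radix_prod _ _ _ (leqnSn s))) Lh.
rewrite -!reweight_eq_upto ?prednK //; [|exact: ltnW..].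
move: (reweight r Q (radix_prod r s).-1) (reweight r Q (radix_prod r s.+1).-1).
move: (reweight r Q n) (reweight_gap r Q s) (Q s) (P_lt s) sn ns p_gt0 q_gt0.
(* From here [p] and [q] are the radix products less one, that is, the indices of the endpoint
   elements. *)
move: (radix_prod r s) (radix_prod r s.+1) => [//|p] [//|q] h c w pq pn nq _ _ a b.
rewrite !succnK -!natr1 => Ea Eb Lh.
have {}Ea : w%:R * p%:R = a%:R + c%:R :> R by rewrite -natrM Ea natrD.
have {}Eb : w%:R * q%:R = b%:R + c%:R :> R by rewrite -natrM Eb natrD.
have {}Lh : w%:R * n%:R <= h%:R + c%:R :> R by rewrite -natrM -natrD ler_nat.
have {}pq : p%:R < q%:R :> R by rewrite ltr_nat.
have -> : a%:R = w%:R * p%:R - c%:R :> R by lra.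
have -> : b%:R = w%:R * q%:R - c%:R :> R by lra.
have : (q%:R - p%:R) * (w%:R * n%:R - c%:R) <= (q%:R - p%:R) * h%:R :> R.
  by rewrite ler_wpM2l //; lra.
by lra.
Qed.

Lemma counting_reweight_max (R : realType) (r Q : nat -> nat) (s : nat) :
  (forall i, (1 < r i)%N) -> (0 < Q 0)%N ->
  counting_fun (range (reweight r Q))
    ((reweight r Q (radix_prod r s).-1)%:R : R) = radix_prod r s.
Proof.
move=> r_gt1 Q0; have g_lt : {homo reweight r Q : i j / (i < j)%N}.
  by move=> i j; apply: reweight_lt.
rewrite (@counting_fun_range _ _ _ (radix_prod r s).-1) ?prednK ?radix_prod_gt0 //.
by rewrite ltr_nat -{2}(prednK (radix_prod_gt0 _ s r_gt1)) g_lt.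
Qed.

(** * Comparison of the two limits superior *)

Lemma limf_esup_le_dominated (T U : choiceType) (X : filteredType T)
    (Y : filteredType U) (R : realType) (f : X -> \bar R) (g : Y -> \bar R)
    (F : set (set X)) (G : set (set Y)) :
  (forall V, G V -> exists2 W, F W &
     forall x, W x -> exists2 y, V y & (f x <= g y)%E) ->
  (limf_esup f F <= limf_esup g G)%E.
Proof.
move=> fg; apply: le_ereal_inf_tmp => _ [V GV <-]; have [W FW WV] := fg V GV.
apply: le_trans (ereal_inf_lbound _) _; first by exists W.
apply: ge_ereal_sup => _ [x Wx <-]; have [y Vy fgxy] := WV x Wx.
by apply: le_trans fgxy _; apply: ereal_sup_ubound; exists y.
Qed.

Lemma SX_reweight (R : realType) (r t Q S : nat -> nat) :
  (forall i, (1 < r i)%N) -> (forall i, (Q i <= Q i.+1)%N) -> (0 < Q 0)%N ->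
  (forall i, (1 < t i)%N) -> (forall i, (S i <= S i.+1)%N) -> (0 < S 0)%N ->
  SX R (range (reweight r Q)) (range (reweight t S)) =
  limn_esup (fun s : nat => (Num.max
    ((radix_prod r s)%:R / Num.sqrt (reweight r Q (radix_prod r s).-1)%:R)
    ((radix_prod t s)%:R / Num.sqrt (reweight t S (radix_prod t s).-1)%:R)
    : R)%:E).
Proof.
move=> r1 Qle Q0 t1 Sle S0; apply/le_anti/andP; split.
  apply: limf_esup_le_dominated => V [N _ NV].
  pose a := (reweight r Q (radix_prod r N.+1).-1)%:R : R.
  pose b := (reweight t S (radix_prod t N.+1).-1)%:R : R.
  exists [set x | Num.max a b < x]%classic.
    by exists (Num.max a b); split; rewrite ?num_real.
  move=> x /=; rewrite gt_max => /andP[/ltW ax /ltW bx].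
  have [j Nj le_j] := @counting_reweight_le R r Q x N.+1 r1 Qle Q0 isT ax.
  have [k Nk le_k] := @counting_reweight_le R t S x N.+1 t1 Sle S0 isT bx.
  (* The indices [j] and [k] may differ; only the one belonging to the larger count is used. *)
  rewrite /maxn; case: ifP => _; [exists k|exists j];
    by rewrite ?lee_fin ?le_max ?le_j ?le_k ?orbT //; apply: NV; rewrite /= ltnW.
apply: limf_esup_le_dominated => V [M [_ MV]].
exists [set s | (Num.truncn M < s)%N]%classic.
  by exists (Num.truncn M).+1.
move=> s /= Ms.
(* The sample points tend to infinity: each is at least the radix product less one, hence at least
   [s]. *)
have big (u U : nat -> nat) : (forall i, (1 < u i)%N) -> (0 < U 0)%N ->
    M < (reweight u U (radix_prod u s).-1)%:R.
  move=> u1 U0; apply: lt_le_trans (truncnS_gt M) _; rewrite ler_nat.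
  apply: leq_trans (reweight_ge u _ _ U0); apply: leq_trans Ms _.
  by have := ltn_radix_prod _ s u1; lia.
have mono (c d : nat) (x : R) :
    (c <= d)%N -> c%:R / Num.sqrt x <= d%:R / Num.sqrt x.
  by move=> cd; rewrite ler_wpM2r ?invr_ge0 ?sqrtr_ge0 // ler_nat.
set u := _ / _; set v := _ / _.
(* The sample point is the element under the root of the larger ratio; there the corresponding count
   is exactly the radix product, and the other count can only help. *)
have [uv|vu] := leP u v.
  exists ((reweight t S (radix_prod t s).-1)%:R : R); first exact/MV/big.
  by rewrite lee_fin mono // [X in maxn _ X]counting_reweight_max // leq_maxr.
exists ((reweight r Q (radix_prod r s).-1)%:R : R); first exact/MV/big.
by rewrite lee_fin mono // [X in maxn X _]counting_reweight_max // leq_maxl.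
Qed.

(** * The sets [A] and [B] as digit sets *)

Lemma mprod_even (m : nat -> nat) (i : nat) :
  mprod m (2 * i) = (radix_prod (fun j => m (2 * j + 1)) i *
                     radix_prod (fun j => m (2 * j + 2)) i)%N.
Proof.
elim: i => [|i IH]; first by rewrite /mprod muln0 big_geq // !radix_prod0.
rewrite mulnS add2n /mprod 2?big_nat_recr //= -/(mprod m (2 * i)) IH !radix_prodS.
by rewrite addn1 addn2 mulnACA -!mulnA.
Qed.

Lemma mprod_odd (m : nat -> nat) (i : nat) :
  mprod m (2 * i + 1) = (radix_prod (fun j => m (2 * j + 2)) i *
                         radix_prod (fun j => m (2 * j + 1)) i.+1)%N.
Proof.
rewrite addn1 /mprod big_nat_recr //= -/(mprod m (2 * i)) mprod_even.
by rewrite radix_prodS addn1 mulnA (mulnC (radix_prod _ _)).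
Qed.

Lemma setA_digit_set (m : nat -> nat) :
  setA m = digit_set (fun i => m (2 * i + 1)%N) (fun i => mprod m (2 * i)).
Proof.
apply/seteqP; split=> [_ [e [N [em e0 ->]]]|_ [d [N [dm d0 ->]]]].
  by exists (fun i => e (2 * i)%N), N.
have half i : (2 * i)./2 = i by rewrite mul2n doubleK.
(* Only even positions matter, and halving inverts [i] to [2 * i]; the values at odd positions are
   arbitrary. *)
exists (fun j => d j./2), N; split=> [i|i Ni|]; rewrite ?half //; first exact: d0.
by apply: eq_bigr => i _; rewrite half.
Qed.

Lemma setB_digit_set (m : nat -> nat) :
  setB m = digit_set (fun i => m (2 * i + 2)%N) (fun i => mprod m (2 * i + 1)).
Proof.
apply/seteqP; split=> [_ [e [N [em e0 ->]]]|_ [d [N [dm d0 ->]]]].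
  by exists (fun i => e (2 * i + 1)%N), N.
have half i : (2 * i + 1)./2 = i by lia.
exists (fun j => d j./2), N; split=> [i|i Ni|]; rewrite ?half //; first exact: d0.
by apply: eq_bigr => i _; rewrite half.
Qed.

Local Close Scope ring_scope.
Local Close Scope nat_scope.

Theorem theorem3 (R : realType) (m : nat -> nat)
    (hm : forall i : nat, (1 <= i)%N -> (2 <= m i)%N) :
  SX R (setA m) (setB m) =
  limn_esup (fun s : nat =>
    (Num.max
      ((\prod_(i < s) m (2 * i + 1))%N%:R /
        Num.sqrt
          (\sum_(i < s) (m (2 * i + 1) - 1) * mprod m (2 * i))%N%:R)
      ((\prod_(i < s) m (2 * i + 2))%N%:R /
        Num.sqrt
          (\sum_(i < s) (m (2 * i + 2) - 1) * mprod m (2 * i + 1))%N%:R)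
      : R)%R%:E).
Proof.
set r := fun i => m (2 * i + 1)%N; set t := fun i => m (2 * i + 2)%N.
have r1 i : (1 < r i)%N by apply: hm; rewrite addn1.
have t1 i : (1 < t i)%N by apply: hm; rewrite addn2.
(* The shift in [S] reflects that the weights of [B] carry one more odd-indexed factor: the first is
   [m 1]. *)
pose Q := radix_prod t; pose S i := radix_prod r i.+1.
have Qle i : (Q i <= Q i.+1)%N by apply: leq_radix_prod.
have Sle i : (S i <= S i.+1)%N by apply: leq_radix_prod.
have Q0 : (0 < Q 0)%N by apply: radix_prod_gt0.
have S0 : (0 < S 0)%N by apply: radix_prod_gt0.
rewrite setA_digit_set setB_digit_set.
rewrite (funext (mprod_even m)) (funext (mprod_odd m)).
rewrite (digit_set_range r Q r1 Qle) (digit_set_range t S t1 Sle).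
rewrite SX_reweight //; congr limn_esup; apply/funext => s.
rewrite !reweight_max //.
by congr (Num.max (_ / Num.sqrt _%:R) (_ / Num.sqrt _%:R))%:E;
  apply: eq_bigr => i _; rewrite ?mprod_even ?mprod_odd.
Qed.
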